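(* Let $(S_n)_{n\ge1}$ be a nonnegative demimartingale and let $\tau$ be a stopping time such that $\tau<\infty$ a.s. and, for every $j\ge1$, $I\{\tau\le j\}$ is a componentwise nondecreasing function of $S_1,\ldots,S_j$. Then $$E(S_\tau)\le E(S_1).$$
   Context: All random variables live on one probability space, and functions are understood to be Borel measurable. $I\{A\}$ denotes the indicator of the event $A$. A sequence of $L^1$ random variables $(S_n)_{n\ge1}$ is a demimartingale if for all $j\ge1$, $E[(S_{j+1}-S_j)f(S_1,\ldots,S_j)]\ge 0$ for all componentwise nondecreasing functions $f:\mathbb{R}^j\to\mathbb{R}$ for which the expectation is defined. A stopping time is a random variable $\tau$ with values in $\{1,2,\ldots\}\cup\{\infty\}$ with $\{\tau\le j\}\in\sigma(S_1,\ldots,S_j)$ for every $j\ge1$. ''$I\{\tau\le j\}$ is a componentwise nondecreasing function of $S_1,\ldots,S_j$'' means $I\{\tau\le j\}=h_j(S_1,\ldots,S_j)$ for some componentwise nondecreasing function $h_j$ on $\mathbb{R}^j$. *)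

(* Defs.v *)
From HB Require Import structures.
From mathcomp Require Import all_boot all_order all_algebra.
From mathcomp Require Import all_classical all_reals all_analysis.

Set Implicit Arguments.
Unset Strict Implicit.
Unset Printing Implicit Defensive.

Import Order.TTheory GRing.Theory Num.Theory.
Import numFieldNormedType.Exports.

Local Open Scope classical_set_scope.
Local Open Scope ring_scope.

(* Sequences (S_n)_{n >= 1} are functions on [nat] whose value at 0 is never
   used; random times with values in {1, 2, ...} \cup {oo} are functions into
   [option nat], with [None] for oo and [Some 0] excluded in [stopping_time]. *)

Definition prefix_vec (T R : Type) (S : nat -> T -> R) (j : nat) (w : T) :
    j.-tuple R :=
  [tuple S i.+1 w | i < j].

Definition componentwise_nondecreasing (R : realType) (j : nat)
    (f : j.-tuple R -> R) : Prop :=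
  forall x y : j.-tuple R,
    (forall i : 'I_j, tnth x i <= tnth y i) -> f x <= f y.

(* 'E_P is total; it is the usual, possibly infinite, expectation of a
   measurable function unless the positive and the negative part both have
   infinite expectation. *)
Definition expectation_defined (d : measure_display) (T : measurableType d)
    (R : realType) (P : probability T R) (X : T -> R) : Prop :=
  ('E_P[X^\+%R] < +oo)%E \/ ('E_P[X^\-%R] < +oo)%E.

Definition demimartingale (d : measure_display) (T : measurableType d)
    (R : realType) (P : probability T R) (S : nat -> T -> R) : Prop :=
  (forall n : nat, (1 <= n)%N -> S n \in Lfun P 1) /\
  forall (j : nat) (f : j.-tuple R -> R), (1 <= j)%N ->
    measurable_fun [set: j.-tuple R] f ->
    componentwise_nondecreasing f ->
    expectation_defined P (fun w => (S j.+1 w - S j w) * f (prefix_vec S j w)) ->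
    (0 <= 'E_P[fun w => ((S j.+1 w - S j w) * f (prefix_vec S j w))%R])%E.

Definition event_le (T : Type) (tau : T -> option nat) (j : nat) : set T :=
  [set w | exists2 n : nat, tau w = Some n & (n <= j)%N].

Definition stopping_time (T : Type) (R : realType) (S : nat -> T -> R)
    (tau : T -> option nat) : Prop :=
  (forall w : T, tau w <> Some 0%N) /\
  forall j : nat, (1 <= j)%N ->
    g_sigma_preimage (fun (i : 'I_j) (w : T) => S i.+1 w) (event_le tau j).

Definition nondecreasing_indicators (T : Type) (R : realType)
    (S : nat -> T -> R) (tau : T -> option nat) : Prop :=
  forall j : nat, (1 <= j)%N ->
    exists h : j.-tuple R -> R,
      [/\ measurable_fun [set: j.-tuple R] h,
          componentwise_nondecreasing h &
          forall w : T, \1_(event_le tau j) w = h (prefix_vec S j w)].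

(* The value 0 on [tau = oo] is a convention, irrelevant for a.s. finite tau. *)
Definition stopped_value (T : Type) (R : realType) (S : nat -> T -> R)
    (tau : T -> option nat) (w : T) : R :=
  if tau w is Some n then S n w else 0.

(* Main.v *)
Require Import Defs.
From HB Require Import structures.
From mathcomp Require Import all_boot all_order all_algebra.
From mathcomp Require Import all_classical all_reals all_analysis.
From mathcomp Require Import measurable_realfun.

Set Implicit Arguments.
Unset Strict Implicit.
Unset Printing Implicit Defensive.

Import Order.TTheory GRing.Theory Num.Theory.
Import numFieldNormedType.Exports.

Local Open Scope classical_set_scope.
Local Open Scope ring_scope.

(** A nonnegative demimartingale is compared with itself stopped at the bounded
    times [min(tau, n)].  Passing from [n] to [n + 1] changes the stopped value
    by [(S_{n+1} - S_n) I{tau > n}], that is,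
      [S_{min(tau, n)} = S_{min(tau, n+1)} + (S_{n+1} - S_n) (I{tau <= n} - 1)].
    The factor [I{tau <= n} - 1] is a bounded, componentwise nondecreasing
    function of [S_1, ..., S_n], so the demimartingale inequality makes the
    last term have nonnegative expectation: the expectations
    [E S_{min(tau, n)}] decrease in [n] from [E S_1]
    ([expectation_stopped_at_le]).

    Since [S >= 0], [S_tau I{tau <= n} <= S_{min(tau, n)}], hence
    [E (S_tau I{tau <= n}) <= E S_1].  The left-hand variables increase to
    [S_tau] (with [S_tau = 0] on [tau = oo]), and monotone convergence
    concludes. *)

Section integrability.
Context (d : measure_display) (T : measurableType d) (R : realType)
  (P : probability T R).

Lemma Lfun1_mul_bounded (X g : T -> R) :
    X \in Lfun P 1 -> measurable_fun [set: T] g ->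
    [bounded g x | x in [set: T]] ->
  (fun w => X w * g w) \in Lfun P 1.
Proof.
move=> /Lfun1_integrable iX mg bg; apply/Lfun1_integrable.
exact: (integrableMl measurableT iX mg bg).
Qed.

Lemma Lfun1_sub (X Y : T -> R) :
  X \in Lfun P 1 -> Y \in Lfun P 1 -> X \- Y \in Lfun P 1.
Proof.
move=> /Lfun1_integrable iX /Lfun1_integrable iY; apply/Lfun1_integrable.
exact: (integrableB measurableT iX iY).
Qed.

Lemma expectation_defined_Lfun1 (X : T -> R) :
  X \in Lfun P 1 -> expectation_defined P X.
Proof.
move=> /Lfun1_integrable /(integrable_funrpos measurableT)/Lfun1_integrable.
move=> /expectation_fin_num; rewrite fin_numE => /andP[_ noo].
by left; rewrite ltey.
Qed.

Lemma measurable_Lfun1 (X : T -> R) :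
  X \in Lfun P 1 -> measurable_fun [set: T] X.
Proof. by move=> /sub_Lfun_mfun; rewrite inE. Qed.

End integrability.

Lemma in_event_le_Some (T : Type) (tau : T -> option nat) (w : T) (k j : nat) :
  tau w = Some k -> (w \in event_le tau j) = (k <= j)%N.
Proof.
move=> tauk; apply/idP/idP => [|kj].
  by rewrite inE => -[n]; rewrite tauk => -[->].
by rewrite inE; exists k.
Qed.

Lemma in_event_le_None (T : Type) (tau : T -> option nat) (w : T) (j : nat) :
  tau w = None -> (w \in event_le tau j) = false.
Proof.
by move=> tauoo; apply/negP; rewrite inE => -[n]; rewrite tauoo.
Qed.

Lemma measurable_event_le (d : measure_display) (T : measurableType d)
    (R : realType) (S : nat -> T -> R) (tau : T -> option nat) (j : nat) :
    (forall n, (1 <= n)%N -> measurable_fun [set: T] (S n)) ->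
    stopping_time S tau -> (1 <= j)%N ->
  measurable (event_le tau j).
Proof.
move=> mS [_ tauS] j1; move: (tauS j j1); apply: smallest_sub.
  exact: sigma_algebra_measurable.
apply: (big_ind (fun C : set (set T) => C `<=` measurable)) => //.
  by move=> A B hA hB C [/hA|/hB].
move=> i _ _ [B mB <-]; exact: mS.
Qed.

(** The value [S_{min(tau, n)}] of the sequence stopped at [min(tau, n)], with
    [min(oo, n) = n]; meant for [n >= 1], as [S 0] carries no information. *)
Definition stopped_at (T : Type) (R : realType) (S : nat -> T -> R)
    (tau : T -> option nat) (n : nat) (w : T) : R :=
  if tau w is Some k then S (minn k n) w else S n w.

Lemma stopped_at_succ (T : Type) (R : realType) (S : nat -> T -> R)
    (tau : T -> option nat) (n : nat) :
  stopped_at S tau n.+1 = stopped_at S tau n \-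
    (fun w => (S n.+1 w - S n w) * (\1_(event_le tau n) w - 1)).
Proof.
apply/funext => w; rewrite /stopped_at /= indicE.
case tauE: (tau w) => [k|]; last first.
  by rewrite (in_event_le_None _ tauE) sub0r mulrN1 opprK addrC subrK.
rewrite (in_event_le_Some _ tauE); case: leqP => kn.
  by rewrite subrr mulr0 subr0 (minn_idPl (leqW kn)).
by rewrite (minn_idPr kn) sub0r mulrN1 opprK addrC subrK.
Qed.

Lemma stopped_at_1 (T : Type) (R : realType) (S : nat -> T -> R)
    (tau : T -> option nat) :
  (forall w, tau w <> Some 0%N) -> stopped_at S tau 1 = S 1%N.
Proof.
move=> tau0; apply/funext => w; rewrite /stopped_at.
by case tauE: (tau w) => [[|k]|] //; case: (tau0 w).
Qed.

Lemma stopped_value_event_le (T : Type) (R : realType) (S : nat -> T -> R)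
    (tau : T -> option nat) (n : nat) (w : T) :
  stopped_value S tau w * \1_(event_le tau n) w =
  stopped_at S tau n w * \1_(event_le tau n) w.
Proof.
rewrite /stopped_value /stopped_at indicE.
case tauE: (tau w) => [k|]; last by rewrite (in_event_le_None _ tauE) !mulr0.
by rewrite (in_event_le_Some _ tauE); case: leqP => kn; rewrite ?mulr0.
Qed.

Section demimartingale_stopping.
Context (d : measure_display) (T : measurableType d) (R : realType)
  (P : probability T R) (S : nat -> T -> R) (tau : T -> option nat).
Hypothesis S_demi : demimartingale P S.
Hypothesis tau_stop : stopping_time S tau.

Let S_Lfun1 n : (1 <= n)%N -> S n \in Lfun P 1.
Proof. by case: S_demi => + _; apply. Qed.

Let measurable_le n : (1 <= n)%N -> measurable (event_le tau n).
Proof.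
move=> n1; apply: measurable_event_le tau_stop n1 => k k1.
exact/measurable_Lfun1/S_Lfun1.
Qed.

Lemma Lfun1_increment (n : nat) : (1 <= n)%N ->
  (fun w => (S n.+1 w - S n w) * (\1_(event_le tau n) w - 1)) \in Lfun P 1.
Proof.
move=> n1; apply: (@Lfun1_mul_bounded _ _ _ _ (S n.+1 \- S n)).
- by apply: Lfun1_sub; exact: S_Lfun1.
- by apply: measurable_funB => //; apply: measurable_indic; exact: measurable_le.
- exists 1; split=> // M M1 w _ /=; apply: le_trans (ltW M1).
  by rewrite indicE; case: (_ \in _); rewrite ?subrr ?normr0// sub0r normrN normr1.
Qed.

Lemma Lfun1_stopped_at (n : nat) : stopped_at S tau n.+1 \in Lfun P 1.
Proof.
elim: n => [|n IHn].
  by rewrite stopped_at_1; [exact: S_Lfun1|case: tau_stop].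
by rewrite stopped_at_succ; apply: Lfun1_sub IHn _; exact: Lfun1_increment.
Qed.

Hypothesis tau_mono : nondecreasing_indicators S tau.

(** The demimartingale inequality for the test function [h_n - 1], where
    [I{tau <= n} = h_n(S_1, ..., S_n)]. *)
Lemma expectation_increment_ge0 (n : nat) : (1 <= n)%N ->
  (0 <= 'E_P[fun w => ((S n.+1 w - S n w) * (\1_(event_le tau n) w - 1))%R])%E.
Proof.
move=> n1; have [h [mh ndh hE]] := tau_mono n1; have [_ demi] := S_demi.
have inc : (fun w => (S n.+1 w - S n w) * (\1_(event_le tau n) w - 1)) =
    (fun w => (S n.+1 w - S n w) * (h (prefix_vec S n w) - 1)).
  by apply/funext => w; rewrite hE.
rewrite inc; apply: (demi n (fun x => h x - 1)) => //.
- exact: measurable_funB.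
- by move=> x y xy; rewrite lerB// ndh.
- by rewrite -inc; exact/expectation_defined_Lfun1/Lfun1_increment.
Qed.

(** Optional stopping at the bounded times [min(tau, n + 1)]; no sign condition
    on [S] is needed here. *)
Lemma expectation_stopped_at_le (n : nat) :
  ('E_P[stopped_at S tau n.+1] <= 'E_P[S 1%N])%E.
Proof.
elim: n => [|n IHn]; first by rewrite stopped_at_1//; case: tau_stop.
rewrite stopped_at_succ expectationB ?Lfun1_stopped_at ?Lfun1_increment//.
apply: le_trans IHn; rewrite leeBlDr ?expectation_fin_num ?Lfun1_increment//.
by rewrite leeDl// expectation_increment_ge0.
Qed.

End demimartingale_stopping.

Theorem theorem3p2 (d : measure_display) (T : measurableType d) (R : realType)
    (P : probability T R) (S : nat -> T -> R) (tau : T -> option nat)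
    (S_demi : demimartingale P S)
    (S_ge0 : forall (n : nat) (w : T), (1 <= n)%N -> 0 <= S n w)
    (tau_stop : stopping_time S tau)
    (tau_fin : {ae P, forall w : T, tau w <> None})
    (tau_mono : nondecreasing_indicators S tau) :
  ('E_P[stopped_value S tau] <= 'E_P[S 1%N])%E.
Proof.
have tau0 : forall w, tau w <> Some 0%N by case: tau_stop.
have stopped_ge0 w : 0 <= stopped_value S tau w.
  rewrite /stopped_value; case tauE: (tau w) => [[|k]|] //.
    by case: (tau0 w).
  exact: S_ge0.
have stopped_at_ge0 n w : 0 <= stopped_at S tau n.+1 w.
  rewrite /stopped_at; case tauE: (tau w) => [[|k]|]; last exact: S_ge0.
    by case: (tau0 w).
  by rewrite minnSS; exact: S_ge0.
have mE n : measurable (event_le tau n.+1).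
  apply: measurable_event_le tau_stop _ => // k k1.
  by apply: (@measurable_Lfun1 _ _ _ P); case: S_demi => + _; apply.
have mstop n : measurable_fun [set: T] (stopped_at S tau n.+1).
  exact/measurable_Lfun1/(Lfun1_stopped_at S_demi tau_stop).
(* [Y n] is [S_tau] restricted to [tau <= n + 1]; unlike [stopped_at], it is
   monotone in [n]. *)
pose Y (n : nat) (w : T) : R :=
  stopped_value S tau w * \1_(event_le tau n.+1) w.
have Y_ge0 n w : 0 <= Y n w by rewrite mulr_ge0.
have mY n : measurable_fun [set: T] (Y n).
  rewrite (_ : Y n = fun w => stopped_at S tau n.+1 w *
      \1_(event_le tau n.+1) w).
    by apply: measurable_funM => //; exact: measurable_indic.
  by apply/funext => w; exact: stopped_value_event_le.
have Y_homo w : {homo (fun n => (Y n w)%:E) : n m / (n <= m)%N >-> (n <= m)%E}.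
  move=> n m nm; rewrite lee_fin ler_wpM2l// !indicE.
  case tauE: (tau w) => [k|]; last by rewrite !(in_event_le_None _ tauE).
  rewrite !(in_event_le_Some _ tauE) ler_nat.
  by case: (leqP k n.+1) => // kn; rewrite (leq_trans kn).
have Y_lim w : limn (fun n => (Y n w)%:E) = (stopped_value S tau w)%:E.
  apply/cvg_lim => //; apply: cvg_near_cst; case tauE: (tau w) => [k|].
    exists k => // n /= kn; rewrite /Y indicE (in_event_le_Some _ tauE).
    by rewrite leqW// mulr1.
  by apply: nearW => n; rewrite /Y /stopped_value tauE mul0r.
have Y_le n : (\int[P]_w (Y n w)%:E <= 'E_P[S 1%N])%E.
  apply: le_trans (expectation_stopped_at_le S_demi tau_stop tau_mono n).
  rewrite unlock; apply: ge0_le_integral => //.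
  - by move=> w _; rewrite lee_fin.
  - exact/measurable_EFinP.
  - exact/measurable_EFinP.
  - move=> w _; rewrite lee_fin /Y stopped_value_event_le indicE.
    by rewrite ler_piMr//; case: (_ \in _).
have Y_cvg : (\int[P]_w (Y n w)%:E)%E @[n --> \oo] -->
    'E_P[stopped_value S tau]%E.
  rewrite unlock; under eq_integral do rewrite -Y_lim.
  apply: (@cvg_monotone_convergence _ _ _ P setT measurableT
    (fun n w => (Y n w)%:E)) => //.
  - by move=> n; exact/measurable_EFinP.
  - by move=> n w _; rewrite lee_fin.
apply: cvge_to_le Y_cvg _; exact: nearW.
Qed.
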